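(* Let $k$ be an algebraically closed field, $n\ge 1$, and let $L\in\mathcal{A}(k^n)$ be an admissible polynomial operator curve such that $\Sigma(L)\neq k$. Then, for every $\lambda_0\in\Sigma(L)$, $$\mathfrak{m}[L,\lambda_0]=i(\mathcal{S}(k^n),L(k);L(\lambda_0)).$$
   Context: $\mathcal{L}(k^n)$ is the space of linear maps $k^n\to k^n$, identified with $n\times n$ matrices and with affine space $\operatorname{Spec}k[x_1,\dots,x_{n^2}]$ (the $x_i$ being the matrix entries). $\mathcal{S}(k^n)$ is the subscheme of non-invertible maps, $\operatorname{Spec}(k[x_1,\dots,x_{n^2}]/\mathfrak{D})$ with $\mathfrak{D}=\langle\det(x_1,\dots,x_{n^2})\rangle$. $\mathcal{P}(k^n)$ is the set of polynomial operator curves $L(\lambda)=\sum_{i=0}^m T_i\lambda^i$ with $T_i\in\mathcal{L}(k^n)$, $T_m\ne 0$. Write $L(\lambda)=(L_i(\lambda))_{1\le i\le n^2}$ for its entries, $L_i\in k[\lambda]$. The curve $L$ is admissible, $L\in\mathcal{A}(k^n)$, if the $k$-subalgebra generated by the entries is everything: $k[L_1(\lambda),\dots,L_{n^2}(\lambda)]=k[\lambda]$. The spectrum is $\Sigma(L)=\{\lambda\in k:\det(L(\lambda))=0\}$, and for $\lambda_0\in\Sigma(L)$ the algebraic multiplicity is $\mathfrak{m}[L,\lambda_0]=\operatorname{ord}_{\lambda=\lambda_0}\det(L(\lambda))$. $L(k)$ denotes the image of $L$ as the closed subscheme $\operatorname{Spec}(k[x_1,\dots,x_{n^2}]/\mathfrak{I})$,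 where $\mathfrak{I}=\ker(\varphi)$ and $\varphi:k[x_1,\dots,x_{n^2}]\to k[\lambda]$, $x_i\mapsto L_i(\lambda)$. Intersection multiplicity (Serre): for subvarieties $X_1,X_2$ of a smooth variety $X$ intersecting properly, and $c$ an isolated point of $X_1\cap X_2$, with ideals $\mathfrak{P}_{X_1},\mathfrak{P}_{X_2}$ in the local ring $\mathcal{O}_{c,X}$, $$i(X_1,X_2;c)=\sum_{i=0}^{\dim X}(-1)^i\,\ell_{\mathcal{O}_{c,X}}\operatorname{Tor}_i^{\mathcal{O}_{c,X}}(\mathcal{O}_{c,X}/\mathfrak{P}_{X_1},\mathcal{O}_{c,X}/\mathfrak{P}_{X_2}),$$ where $\ell$ is module length. When $X_1,X_2$ are Cohen--Macaulay this equals $\ell_{\mathcal{O}_{c,X}}(\mathcal{O}_{c,X}/(\mathfrak{P}_{X_1}+\mathfrak{P}_{X_2}))$. Here $X=\mathcal{L}(k^n)$. *)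

(* Defs.v *)
From HB Require Import structures.
From mathcomp Require Import all_boot all_order all_algebra.
From mathcomp Require Import generic_quotient ring_quotient fraction.
From mathcomp Require Import boolp classical_sets.
From mathcomp Require Import mpoly.

Set Implicit Arguments.
Unset Strict Implicit.
Unset Printing Implicit Defensive.

Import GRing.Theory.
Local Open Scope ring_scope.

Local Notation "x %:F" := (@FracField.tofrac _ x) : ring_scope.

Section CyclicModule.
Variables (R : comNzRingType) (S : R -> Prop).

Definition ideal_gen : {pred R^o} := fun x =>
  `[< exists s : seq (R * R),
        (forall p, p \in s -> S p.2) /\ x = \sum_(p <- s) p.1 * p.2 >].

Lemma ideal_gen_submod : submod_closed ideal_gen.
Proof.
split; first by apply/asboolP; exists [::]; rewrite big_nil.
move=> a _ _ /asboolP [s [Ss ->]] /asboolP [t [St ->]]; apply/asboolP.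
exists ([seq (a * p.1, p.2) | p <- s] ++ t); split.
  move=> p; rewrite mem_cat => /orP [/mapP [q qs ->]|]; last exact: St.
  exact: Ss qs.
rewrite big_cat big_map /=; congr (_ + _).
rewrite /GRing.scale /= mulr_sumr; apply: eq_bigr => p _.
by rewrite mulrA.
Qed.

HB.instance Definition _ := GRing.isSubmodClosed.Build R R^o ideal_gen
  ideal_gen_submod.

(* The R-module R / (S). *)
Definition cyclic_module : Type := Quotient.quot ideal_gen.
HB.instance Definition _ := GRing.Zmodule.on cyclic_module.

Definition cyclic_proj (x : R) : cyclic_module :=
  (\pi_(Quotient.quot ideal_gen) (x : R^o))%qT.

Definition cyclic_scale (a : R) (x : cyclic_module) : cyclic_module :=
  cyclic_proj (a * repr (x : Quotient.quot ideal_gen)).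

Lemma cyclic_projP (x : cyclic_module) :
  cyclic_proj (repr (x : Quotient.quot ideal_gen)) = x.
Proof. exact: reprK. Qed.

Lemma cyclic_proj_eq (x y : R) :
  (cyclic_proj x == cyclic_proj y) = (x - y \in ideal_gen).
Proof. by rewrite Quotient.idealrBE. Qed.

Lemma cyclic_projD (x y : R) :
  cyclic_proj (x + y) = cyclic_proj x + cyclic_proj y.
Proof. exact: (raddfD (\pi_(Quotient.quot ideal_gen))%qT). Qed.

Lemma cyclic_scaleE (a x : R) :
  cyclic_scale a (cyclic_proj x) = cyclic_proj (a * x).
Proof.
apply/eqP; rewrite cyclic_proj_eq -mulrBr.
apply: (rpredZ a (_ : _ \in ideal_gen)).
by rewrite -cyclic_proj_eq cyclic_projP.
Qed.

Fact cyclic_scaleA a b x :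
  cyclic_scale a (cyclic_scale b x) = cyclic_scale (a * b) x.
Proof. by rewrite -[x]cyclic_projP !cyclic_scaleE mulrA. Qed.

Fact cyclic_scale1 : left_id 1 cyclic_scale.
Proof. by move=> x; rewrite -[x]cyclic_projP cyclic_scaleE mul1r. Qed.

Fact cyclic_scaleDr : right_distributive cyclic_scale +%R.
Proof.
move=> a x y; rewrite -[x]cyclic_projP -[y]cyclic_projP -cyclic_projD.
by rewrite !cyclic_scaleE mulrDr cyclic_projD.
Qed.

Fact cyclic_scaleDl x : {morph cyclic_scale^~ x : a b / a + b}.
Proof.
by move=> a b; rewrite -[x]cyclic_projP !cyclic_scaleE mulrDl cyclic_projD.
Qed.

HB.instance Definition _ := GRing.Zmodule_isLmodule.Build R cyclic_module
  cyclic_scaleA cyclic_scale1 cyclic_scaleDr cyclic_scaleDl.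

End CyclicModule.

(* [has_length A B l]: the R-module A / B has finite length l, for submodules
   B <= A of V; submodules of A / B are the submodules of V between B and A. *)
Section Length.
Variables (R : comNzRingType) (V : lmodType R).

Definition submodule_chain (A B : {pred V}) (l : nat) (C : nat -> {pred V}) :=
  [/\ forall i, (i <= l)%N ->
        [/\ submod_closed (C i), {subset B <= C i} & {subset C i <= A}]
    & forall i, (i < l)%N ->
        {subset C i <= C i.+1} /\ ~ {subset C i.+1 <= C i}].

Definition has_length (A B : {pred V}) (l : nat) :=
  (exists C, submodule_chain A B l C) /\
  (forall m C, submodule_chain A B m C -> (m <= l)%N).

End Length.

Section Tor.
Variable R : comNzRingType.

(* ... -> R^(rk 2) -> R^(rk 1) -> R^(rk 0), acting on row vectors. *)
Record free_complex := FreeComplex {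
  rk : nat -> nat;
  bd : forall i, 'M[R]_(rk i.+1, rk i) }.

Definition free_resolution (M : lmodType R) (F : free_complex) :=
  exists e : {linear 'rV[R]_(rk F 0) -> M},
  [/\ forall x, exists v, e v = x,
      forall v, e v = 0 <-> exists w, v = w *m bd F 0
    & forall i (v : 'rV_(rk F i.+1)),
        v *m bd F i = 0 <-> exists w, v = w *m bd F i.+1].

Variables (F : free_complex) (N : lmodType R).

(* Under R^p (x) N = N^p, the map D (x) N induced by D : R^p -> R^q. *)
Definition tensor_map p q (D : 'M[R]_(p, q)) (v : {ffun 'I_p -> N}) :
  {ffun 'I_q -> N} := [ffun j => \sum_i D i j *: v i].

Definition cycles i : {pred {ffun 'I_(rk F i) -> N}} :=
  match i with
  | 0 => predT
  | i.+1 => fun v => tensor_map (bd F i) v == 0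
  end.

Definition boundaries i : {pred {ffun 'I_(rk F i) -> N}} :=
  fun v => `[< exists w, v = tensor_map (bd F i) w >].

End Tor.

Arguments cycles {R} F N i.
Arguments boundaries {R} F N i.

(* The length of Tor_i(M, N) = H_i(F (x) N), F a resolution of M by free
   modules of finite rank (these exist for M finitely generated over a
   Noetherian ring); the value is 0 if this length is not finite. *)
Definition tor_length (R : comNzRingType) (M N : lmodType R) (i : nat) : nat :=
  xget 0%N [set l | exists F, free_resolution M F /\
    has_length (cycles F N i) (boundaries F N i) l].

(* The local ring of affine N-space at the k-point c. *)
Section LocalRing.
Variables (k : fieldType) (N : nat) (c : 'I_N -> k).

Definition regular_at : {pred {fraction {mpoly k[N]}}} := fun f =>
  `[< exists p q : {mpoly k[N]}, q.@[c] != 0 /\ f = p%:F / q%:F >].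

Lemma regular_at_subring : subring_closed regular_at.
Proof.
have nz q : q.@[c] != 0 -> (q : {mpoly k[N]})%:F != 0 :> {fraction _}.
  by apply: contraNneq => /eqP; rewrite tofrac_eq0 => /eqP ->; rewrite meval0.
split.
- apply/asboolP; exists 1, 1; split; last by rewrite tofrac1 divr1.
  by rewrite meval1 oner_neq0.
- move=> _ _ /asboolP [p [q [q0 ->]]] /asboolP [r [s [s0 ->]]]; apply/asboolP.
  exists (p * s - r * q), (q * s); split; first by rewrite mevalM mulf_neq0.
  by rewrite -mulNr addf_div ?nz // tofracB !tofracM mulNr.
- move=> _ _ /asboolP [p [q [q0 ->]]] /asboolP [r [s [s0 ->]]]; apply/asboolP.
  exists (p * r), (q * s); split; first by rewrite mevalM mulf_neq0.
  by rewrite mulf_div !tofracM.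
Qed.

HB.instance Definition _ := GRing.isSubringClosed.Build
  {fraction {mpoly k[N]}} regular_at regular_at_subring.

Definition local_ring := {f | f \in regular_at}.
HB.instance Definition _ := SubChoice.on local_ring.
HB.instance Definition _ :=
  [SubChoice_isSubComNzRing of local_ring by <:].

Lemma regular_at_poly (p : {mpoly k[N]}) : p%:F \in regular_at.
Proof.
apply/asboolP; exists p, 1; split; last by rewrite tofrac1 divr1.
by rewrite meval1 oner_neq0.
Qed.

Definition germ (p : {mpoly k[N]}) : local_ring := Sub p%:F (regular_at_poly p).

(* O_{c,X} / P_Y, for the closed subscheme Y of ideal I. *)
Definition local_module (I : {pred {mpoly k[N]}}) : lmodType local_ring :=
  cyclic_module (fun f : local_ring => exists2 p, p \in I & f = germ p).

(* Serre's formula, for the closed subschemes of ideals I1 and I2. *)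
Definition intersection_multiplicity (I1 I2 : {pred {mpoly k[N]}}) : int :=
  \sum_(i < N.+1)
    (-1) ^+ i * (tor_length (local_module I1) (local_module I2) i)%:Z.

End LocalRing.

Section OperatorCurves.
Variables (k : closedFieldType) (n : nat).
Implicit Types (L : {poly 'M[k]_n.+1}) (l : k).

(* The dimension of the space of linear maps on k^(n.+1). *)
Definition adim := (n.+1 * n.+1)%N.

Definition curve_mx L : 'M[{poly k}]_n.+1 :=
  \matrix_(i, j) \poly_(m < size L) (L`_m i j).

Definition curve_at L l : 'M[k]_n.+1 := \sum_(m < size L) l ^+ m *: L`_m.

Definition curve_coord L (a : 'I_adim) : {poly k} := mxvec (curve_mx L) 0 a.

Definition curve_point L l (a : 'I_adim) : k := mxvec (curve_at L l) 0 a.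

(* x_a |-> L_a(lambda). *)
Definition curve_comorphism L (p : {mpoly k[adim]}) : {poly k} :=
  mmap (@polyC k) (curve_coord L) p.

(* The range of the comorphism is the subalgebra k[L_1, ..., L_adim]. *)
Definition admissible L :=
  L != 0 /\ forall q : {poly k}, exists p, curve_comorphism L p = q.

Definition spectrum L : {pred k} := fun l => \det (curve_at L l) == 0.

Definition alg_mult L l : nat := mup l (\det (curve_mx L)).

Definition generic_mx : 'M[{mpoly k[adim]}]_n.+1 :=
  \matrix_(i, j) 'X_(mxvec_index i j).

Definition singular_ideal : {pred {mpoly k[adim]}} :=
  fun p => `[< exists q, p = q * \det generic_mx >].

Definition curve_ideal L : {pred {mpoly k[adim]}} :=
  fun p => curve_comorphism L p == 0.

End OperatorCurves.

Arguments singular_ideal : clear implicits.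

(* Main.v *)
(* Let f be the determinant, O the local ring at L(l0), and N the local ring of
   the curve as an O-module. Every free resolution of O/(f) is homotopy
   equivalent to the Koszul complex 0 -> O -> O, and f is a nonzerodivisor on N;
   so Tor_i(O/(f), N) vanishes for i > 0 and Tor_0 = N/fN. By admissibility there
   is a polynomial t that restricts to X - l0 on the curve, and then every
   nonzero element of N is a unit times a power of t. On N, f is a unit times t^m
   with m the order of det L at l0, and N/t^mN has length m. *)
Require Import Defs.
From HB Require Import structures.
From mathcomp Require Import all_boot all_order all_algebra.
From mathcomp Require Import fraction boolp classical_sets.
From mathcomp Require Import mpoly.

Set Implicit Arguments.
Unset Strict Implicit.
Unset Printing Implicit Defensive.

Import GRing.Theory.
Local Open Scope ring_scope.

(** * Tensoring matrices with a module *)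

Section TensorMap.
Variables (R : comNzRingType) (N : lmodType R).

Lemma tensor_mapE p q (D : 'M[R]_(p, q)) (v : {ffun 'I_p -> N}) j :
  tensor_map D v j = \sum_i D i j *: v i.
Proof. by rewrite ffunE. Qed.

Lemma tensor_map_linear p q (D : 'M[R]_(p, q)) :
  linear (tensor_map D : {ffun 'I_p -> N} -> {ffun 'I_q -> N}).
Proof.
move=> a u v; apply/ffunP => j; rewrite !ffunE scaler_sumr -big_split /=.
apply: eq_bigr => i _; rewrite !ffunE scalerDr; congr (_ + _).
by rewrite !scalerA mulrC.
Qed.

HB.instance Definition _ p q (D : 'M[R]_(p, q)) :=
  GRing.isLinear.Build R {ffun 'I_p -> N} {ffun 'I_q -> N} _ (tensor_map D)
    (tensor_map_linear D).

(** Matrices act on row vectors from the right, so the left factor is applied first. *)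
Lemma tensor_map_mul p q r (A : 'M[R]_(p, q)) (B : 'M[R]_(q, r))
    (v : {ffun 'I_p -> N}) :
  tensor_map (A *m B) v = tensor_map B (tensor_map A v).
Proof.
apply/ffunP => j; rewrite !tensor_mapE.
under [RHS]eq_bigr do rewrite tensor_mapE scaler_sumr.
rewrite exchange_big /=; apply: eq_bigr => i _.
rewrite mxE scaler_suml; apply: eq_bigr => l _.
by rewrite scalerA mulrC.
Qed.

Lemma tensor_mapD p q (A B : 'M[R]_(p, q)) (v : {ffun 'I_p -> N}) :
  tensor_map (A + B) v = tensor_map A v + tensor_map B v.
Proof.
apply/ffunP => j; rewrite !ffunE -big_split /=.
by apply: eq_bigr => i _; rewrite mxE scalerDl.
Qed.

Lemma tensor_map_scale p q a (A : 'M[R]_(p, q)) (v : {ffun 'I_p -> N}) :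
  tensor_map (a *: A) v = a *: tensor_map A v.
Proof.
apply/ffunP => j; rewrite !ffunE scaler_sumr.
by apply: eq_bigr => i _; rewrite mxE scalerA.
Qed.

Lemma tensor_map1 p (v : {ffun 'I_p -> N}) : tensor_map 1%:M v = v.
Proof.
apply/ffunP => j; rewrite tensor_mapE (bigD1 j) //= mxE eqxx scale1r.
by rewrite big1 ?addr0 // => i ij; rewrite mxE (negPf ij) scale0r.
Qed.

Lemma boundariesP (F : free_complex R) i (v : {ffun 'I_(rk F i) -> N}) :
  reflect (exists w, v = tensor_map (bd F i) w) (v \in boundaries F N i).
Proof. exact: asboolP. Qed.

End TensorMap.

(** * Lengths of subquotients *)

Section Length.
Variable R : comNzRingType.

Lemma has_length_uniq (V : lmodType R) (A B : {pred V}) l m :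
  has_length A B l -> has_length A B m -> l = m.
Proof.
move=> [[C chC] maxl] [[C' chC'] maxm]; apply/eqP.
by rewrite eqn_leq (maxm _ _ chC) (maxl _ _ chC').
Qed.

(** A chain of positive length needs a strict step from [C 0] to [C 1], but [C 1] lies in [A], hence
    in [B], hence in [C 0]. *)
Lemma has_length_eq0 (V : lmodType R) (A B : {pred V}) l :
  {subset A <= B} -> has_length A B l -> l = 0%N.
Proof.
move=> AB [[C [btw strict]] _]; case: l btw strict => // l btw strict.
have [_ []] := strict 0%N isT.
have [_ _ C1A] := btw 1%N isT; have [_ BC0 _] := btw 0%N isT.
by move=> x /C1A /AB /BC0.
Qed.

(** [phi] induces a surjection from [V/B] onto [W/B'], and taking preimages under a surjection
    preserves strict inclusions. *)
Lemma submodule_chain_preim (V W : lmodType R) (phi : {linear V -> W})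
    (B : {pred V}) (B' : {pred W}) l C :
  (forall x, x \in B -> phi x \in B') ->
  (forall y, exists x, y - phi x \in B') ->
  submodule_chain predT B' l C ->
  submodule_chain predT B l (fun i x => phi x \in C i).
Proof.
move=> phiB phi_surj [btw strict]; split=> i il.
  have [[C0 CZ] B'C _] := btw i il; split => //.
    by split=> [|a x y]; rewrite !unfold_in ?linear0 // linearP; apply: CZ.
  by move=> x /phiB /B'C.
have [CC nCC] := strict i il; split; first by move=> x; apply: CC.
(* [y] is replaced by a representative [phi x]; the difference lies in [B'], hence in every term of
   the chain. *)
move=> sub; apply: nCC => y yC; have [x xB'] := phi_surj y.
have [[C0 CZ] B'C _] := btw i (ltnW il).
have [[_ CZ1] B'C1 _] := btw i.+1 il.
have phix1 : phi x \in C i.+1.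
  have -> : phi x = (-1) *: (y - phi x) + y by rewrite scaleN1r opprB subrK.
  by apply: CZ1 => //; apply: B'C1.
have phix := sub x phix1.
have -> : y = 1 *: phi x + (y - phi x) by rewrite scale1r addrC subrK.
by apply: CZ => //; apply: B'C.
Qed.

(** Surjections between [V/B] and [W/B'] in both directions suffice: pulling back along [phi] gives
    a chain of length [l], pulling back along [psi] bounds every chain. *)
Lemma has_length_transfer (V W : lmodType R) (phi : {linear V -> W})
    (psi : {linear W -> V}) (B : {pred V}) (B' : {pred W}) l :
  (forall x, x \in B -> phi x \in B') ->
  (forall y, exists x, y - phi x \in B') ->
  (forall y, y \in B' -> psi y \in B) ->
  (forall x, exists y, x - psi y \in B) ->
  has_length predT B' l -> has_length predT B l.
Proof.
move=> phiB phi_surj psiB psi_surj [[C chC] maxl]; split.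
  by exists (fun i x => phi x \in C i); apply: submodule_chain_preim chC.
move=> m C' /(submodule_chain_preim psiB psi_surj); exact: maxl.
Qed.

End Length.

(** * Tor of R/(f) against a module on which f is regular *)

Definition multiples (R : comNzRingType) (N : lmodType R) (f : R) : {pred N} :=
  fun x => `[< exists y, x = f *: y >].

Arguments multiples {R} N f.

Lemma multiplesP (R : comNzRingType) (N : lmodType R) (f : R) (x : N) :
  reflect (exists y, x = f *: y) (x \in multiples N f).
Proof. exact: asboolP. Qed.

Section HypersurfaceTor.
Variables (R : comNzRingType) (f : R).
Hypothesis f_reg : forall x, f * x = 0 -> x = 0.
Variables (M : lmodType R) (g : M).
Hypothesis g_gen : forall x : M, exists a, x = a *: g.
Hypothesis g_ann : forall a, a *: g = 0 <-> exists b, a = f * b.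

Definition koszul_rk i : nat := (i < 2)%N.

Definition koszul_bd i : 'M[R]_(koszul_rk i.+1, koszul_rk i) :=
  match i return 'M_(koszul_rk i.+1, koszul_rk i) with
  | 0 => f%:M
  | _ => 0
  end.

Definition koszul := FreeComplex koszul_bd.

Definition gen_map (v : 'rV[R]_1) : M := v 0 0 *: g.

Fact gen_map_linear : linear gen_map.
Proof. by move=> a u v; rewrite /gen_map !mxE scalerDl scalerA. Qed.

HB.instance Definition _ :=
  GRing.isLinear.Build R 'rV[R]_1 M _ gen_map gen_map_linear.

(** [g_gen] and [g_ann] identify [M] with R/(f), and [f_reg] makes the differential injective. The
    existence of this resolution keeps [tor_length] in degree 0 from falling back on its default. *)
Lemma koszul_resolution : free_resolution M koszul.
Proof.
exists gen_map; split.
- move=> x; have [a ->] := g_gen x; exists a%:M.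
  by rewrite /= /gen_map mxE eqxx mulr1n.
- move=> v; rewrite /= /gen_map g_ann; split=> [[b vb]|[w ->]].
    exists b%:M; rewrite -scalar_mxM mulrC -vb; exact: mx11_scalar.
  by exists (w 0 0); rewrite mul_mx_scalar mxE.
- case=> [|i] v /=; last first.
    split=> [_|[w ->]]; last by rewrite !mulmx0.
    by exists 0; apply/matrixP => ? [].
  split=> [vf|[w ->]]; last by rewrite mulmx0 mul0mx.
  exists 0; rewrite mulmx0; apply/matrixP => i j; rewrite [RHS]mxE.
  apply: f_reg; move/matrixP/(_ i j): vf.
  by rewrite mul_mx_scalar !mxE.
Qed.

Lemma lift_rows p q r (A : 'M[R]_(p, r)) (B : 'M[R]_(q, r)) :
  (forall i, exists w, row i A = w *m B) -> exists W, A = W *m B.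
Proof.
move=> /fin_all_exists [w wP]; exists (\matrix_i w i).
by apply/row_matrixP => i; rewrite row_mul rowK.
Qed.

(** The lifting step of the comparison theorem: each row of [A] lies in the kernel of [B], and lifts
    of the rows assemble into one matrix. *)
Lemma lift_kernel p q r s (A : 'M[R]_(p, q)) (B : 'M[R]_(q, r))
    (C : 'M[R]_(s, q)) :
  (forall v : 'rV_q, v *m B = 0 <-> exists w, v = w *m C) ->
  A *m B = 0 -> exists W, A = W *m C.
Proof.
move=> ex AB; apply: lift_rows => i; apply/ex.
by rewrite -row_mul AB row0.
Qed.

Variable F : free_complex R.
Hypothesis F_res : free_resolution M F.

(* A homotopy equivalence between [F] and the Koszul complex: [eps], [gam] is
   the chain map from [F], [u], [w] the one to [F], and [S], [T] are the first
   two components of the homotopy on [F]. *)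
Lemma resolution_homotopy :
  exists (eps : 'cV[R]_(rk F 0)) (u : 'rV[R]_(rk F 0))
    (gam : 'cV[R]_(rk F 1)) (w : 'rV[R]_(rk F 1)) S T t,
  [/\ u *m eps = (1 + f * t)%:M, bd F 0 *m eps = f *: gam,
      f *: u = w *m bd F 0, 1%:M - eps *m u = S *m bd F 0
    & 1%:M - bd F 0 *m S - gam *m w = T *m bd F 1 /\ bd F 1 *m gam = 0].
Proof.
have [e [e_surj e_ker F_ex]] := F_res.
have dd i : bd F i.+1 *m bd F i = 0.
  apply/row_matrixP => j; rewrite row_mul row0.
  by apply/F_ex; exists (delta_mx 0 j); rewrite -rowE.
have [a aP] := fin_all_exists (fun i => g_gen (e (delta_mx 0 i))).
pose eps : 'cV[R]_(rk F 0) := \col_i a i.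
have eE v : e v = (v *m eps) 0 0 *: g.
  rewrite {1}[v]row_sum_delta linear_sum mxE scaler_suml; apply: eq_bigr => i _.
  by rewrite linearZ /= aP scalerA mxE.
have [u uP] := e_surj g.
(* [u] lifts [g], so [u *m eps - 1] annihilates [g]; the quotient [t] by [f] is the homotopy on the
   Koszul side. *)
have [t tP] : exists t, (u *m eps) 0 0 - 1 = f * t.
  by apply/g_ann; rewrite scalerBl -eE uP scale1r subrr.
have ueps : u *m eps = (1 + f * t)%:M.
  by rewrite [LHS]mx11_scalar -tP addrC subrK.
have [w wP] : exists w, f *: u = w *m bd F 0.
  apply/e_ker; rewrite linearZ uP; apply/g_ann.
  by exists 1; rewrite mulr1.
have [S SP] : exists S, 1%:M - eps *m u = S *m bd F 0.
  apply: lift_rows => i; apply/e_ker; rewrite eE; apply/g_ann.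
  exists (- (a i * t)); rewrite -row_mul mulmxBl mul1mx -mulmxA ueps.
  rewrite mul_mx_scalar !mxE mulrDl mul1r opprD addrA subrr add0r mulrN.
  by rewrite [a i * t]mulrC mulrA.
have [gam gamP] : exists gam : 'cV[R]_(rk F 1), bd F 0 *m eps = f *: gam.
  have /fin_all_exists [c cP] : forall i, exists b, (bd F 0 *m eps) i 0 = f * b.
    move=> i; apply/g_ann; have := eE (row i (bd F 0)).
    rewrite -row_mul mxE => <-; apply/e_ker.
    by exists (delta_mx 0 i); rewrite -rowE.
  by exists (\col_i c i); apply/colP => i; rewrite cP !mxE.
(* What follows from [dd] is that [f] times this product vanishes; regularity of [f] cancels the
   factor. *)
have dgam : bd F 1 *m gam = 0.
  apply/matrixP => i j; rewrite [RHS]mxE; apply: f_reg.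
  have : bd F 1 *m (bd F 0 *m eps) = 0 by rewrite mulmxA dd mul0mx.
  by rewrite gamP -scalemxAr => /matrixP/(_ i j); rewrite !mxE.
have [T TP] : exists T, 1%:M - bd F 0 *m S - gam *m w = T *m bd F 1.
  (* Multiplied by [bd F 0], the left side becomes [bd F 0 *m eps *m u - f *: gam *m u], which is
     zero by [gamP]. *)
  apply: lift_kernel (F_ex 0%N) _.
  rewrite !mulmxBl mul1mx -!mulmxA -SP -wP mulmxBr mulmx1 mulmxA gamP.
  by rewrite -scalemxAr -scalemxAl subKr subrr.
by exists eps, u, gam, w, S, T, t.
Qed.

(** The Koszul complex vanishes in degrees at least 2, so there the identity of [F] is
    null-homotopic. The homotopy is built by induction, lifting through the exactness of [F]. *)
Lemma resolution_homotopy_high i : exists T U,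
  1%:M - bd F i.+1 *m T = U *m bd F i.+2.
Proof.
have [_ [_ [gam [w [S [T [_ [_ _ _ _ [TP dgam]]]]]]]]] := resolution_homotopy.
have [e [_ _ F_ex]] := F_res.
have dd j : bd F j.+1 *m bd F j = 0.
  apply/row_matrixP => l; rewrite row_mul row0.
  by apply/F_ex; exists (delta_mx 0 l); rewrite -rowE.
elim: i => [|i [T' [U UP]]].
  exists T; apply: lift_kernel (F_ex 1%N) _.
  rewrite mulmxBl mul1mx -mulmxA -TP !mulmxBr mulmx1 !mulmxA dd dgam !mul0mx.
  by rewrite !subr0 subrr.
exists U; apply: lift_kernel (F_ex i.+2) _.
rewrite mulmxBl mul1mx -mulmxA -UP mulmxBr mulmx1 mulmxA dd mul0mx.
by rewrite subr0 subrr.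
Qed.

Variable N : lmodType R.
Hypothesis f_regN : forall x : N, f *: x = 0 -> x = 0.

(** The homotopy applied to a cycle [v] writes it as a boundary. In degree 1 the extra term
    [tensor_map gam v] vanishes: [f] kills it because [f *: gam] factors through [bd F 0], and [f]
    is regular on [N]. *)
Lemma hypersurface_tor_acyclic i :
  {subset cycles F N i.+1 <= boundaries F N i.+1}.
Proof.
case: i => [|i] v; rewrite unfold_in /= => /eqP vK; apply/boundariesP.
  have [eps [u [gam [w [S [T [t [_ gamP _ _ [TP _]]]]]]]]] :=
    resolution_homotopy.
  have vgam : tensor_map gam v = 0.
    apply/ffunP => j; rewrite [RHS]ffunE; apply: f_regN.
    have := congr1 (fun h : {ffun 'I_1 -> N} => h j)
      (tensor_map_scale f gam v).
    by rewrite -gamP tensor_map_mul vK linear0 !ffunE => <-.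
  exists (tensor_map T v); rewrite -tensor_map_mul -TP.
  rewrite -!scaleN1r !tensor_mapD !tensor_map_scale !tensor_map_mul vK vgam.
  by rewrite !linear0 ?scaler0 !addr0 tensor_map1.
have [T [U UP]] := resolution_homotopy_high i.
exists (tensor_map U v); rewrite -tensor_map_mul -UP.
rewrite -!scaleN1r !tensor_mapD !tensor_map_scale !tensor_map_mul vK.
by rewrite !linear0 ?scaler0 !addr0 tensor_map1.
Qed.

(** [eps] and [u] induce mutually inverse maps between H_0 and N/fN: one composite is the identity
    up to the homotopy [S], the other is multiplication by 1 + f t. *)
Lemma hypersurface_tor0_length l :
  has_length predT (multiples N f) l ->
  has_length (cycles F N 0) (boundaries F N 0) l.
Proof.
have [eps [u [gam [w [S [T [t [ueps gamP wP SP _]]]]]]]] := resolution_homotopy.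
pose phi (v : {ffun 'I_(rk F 0) -> N}) : N := tensor_map eps v 0.
have phiL : linear phi by move=> a x y; rewrite /phi linearP !ffunE.
pose psi (x : N) : {ffun 'I_(rk F 0) -> N} :=
  tensor_map u [ffun=> x].
have psiL : linear psi.
  move=> a x y; rewrite /psi -linearP; congr tensor_map.
  by apply/ffunP => i; rewrite !ffunE.
pose phiM := HB.pack_for {linear {ffun 'I_(rk F 0) -> N} -> N} phi
  (GRing.isLinear.Build _ _ _ _ phi phiL).
pose psiM := HB.pack_for {linear N -> {ffun 'I_(rk F 0) -> N}} psi
  (GRing.isLinear.Build _ _ _ _ psi psiL).
have psiphi v : v - psi (phi v) \in boundaries F N 0.
  apply/boundariesP; exists (tensor_map S v); rewrite -tensor_map_mul -SP.
  rewrite -[- (eps *m u)]scaleN1r tensor_mapD tensor_map_scale tensor_map1.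
  rewrite tensor_map_mul scaleN1r; congr (_ - tensor_map u _).
  by apply/ffunP => i; rewrite ffunE ord1.
have phipsi x : phi (psi x) = (1 + f * t) *: x.
  by rewrite /phi /psi -tensor_map_mul ueps tensor_mapE big_ord1 mxE eqxx ffunE.
apply: (@has_length_transfer _ _ _ phiM psiM).
- move=> v /boundariesP [y ->] /=; apply/multiplesP.
  exists (tensor_map gam y 0).
  by rewrite /phi -tensor_map_mul gamP tensor_map_scale ffunE.
- move=> y; exists (psi y); rewrite /= phipsi; apply/multiplesP.
  exists (- (t *: y)); rewrite scalerDl scale1r opprD addrA subrr add0r.
  by rewrite scalerN scalerA.
- move=> y /multiplesP [x ->] /=; apply/boundariesP.
  exists (tensor_map w [ffun=> x]).
  rewrite -tensor_map_mul -wP tensor_map_scale /psi -linearZ /=.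
  by congr tensor_map; apply/ffunP => i; rewrite !ffunE.
- by move=> v; exists (phi v); apply: psiphi.
Qed.

End HypersurfaceTor.

(** [tor_length] chooses a length over an unspecified resolution, so the value must be the same for
    every resolution; the Koszul complex supplies existence in degree 0. *)
Lemma hypersurface_tor_length (R : comNzRingType) (f : R) (M N : lmodType R)
    (g : M) l :
  (forall x, f * x = 0 -> x = 0) ->
  (forall x : M, exists a, x = a *: g) ->
  (forall a, a *: g = 0 <-> exists b, a = f * b) ->
  (forall x : N, f *: x = 0 -> x = 0) ->
  has_length predT (multiples N f) l ->
  forall i, tor_length M N i = if i is 0 then l else 0%N.
Proof.
move=> f_reg g_gen g_ann f_regN len; case=> [|i].
  have len0 := hypersurface_tor0_length f_reg g_gen g_ann _ len.
  apply: xget_subset1.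
    exists (koszul f); split; first exact: koszul_resolution g_ann.
    exact/len0/(koszul_resolution f_reg g_gen).
  move=> l1 l2 [F1 [/len0 len1 len1']] [F2 [/len0 len2 len2']].
  by rewrite (has_length_uniq len1' len1) (has_length_uniq len2' len2).
(* The default 0 of [xget] is already the claimed value; any chosen length is that of cycles which
   are all boundaries. *)
rewrite /tor_length; case: xgetP => // l' _ [F [F_res]].
apply: has_length_eq0.
exact: (hypersurface_tor_acyclic f_reg g_gen g_ann F_res f_regN).
Qed.


(** * Length of N/t^m N for a module resembling a discrete valuation ring *)

Section UniserialLength.
Variables (R : comNzRingType) (N : lmodType R) (g : N) (t : R).
Hypothesis uniserial : forall x : N, x = 0 \/ exists j a b,
  x = (a * t ^+ j) *: g /\ t ^+ j *: g = b *: x.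
Hypothesis strict : forall j a, t ^+ j *: g <> (a * t ^+ j.+1) *: g.

Lemma multiples_submod f : submod_closed (multiples N f).
Proof.
split; first by apply/multiplesP; exists 0; rewrite scaler0.
move=> a x y /multiplesP [x' ->] /multiplesP [y' ->]; apply/multiplesP.
by exists (a *: x' + y'); rewrite scalerDr !scalerA mulrC.
Qed.

(** Every nonzero element is associate to some t^j g. The powers of [t] give a chain of length [m].
    Along any chain, the least [j] with t^j g in [C i] is at most [m] at the start and drops at
    every step. *)
Lemma uniserial_length m : has_length predT (multiples N (t ^+ m)) m.
Proof.
split.
  exists (fun i => multiples N (t ^+ (m - i))); split=> i im.
    split=> //; first exact: multiples_submod.
    move=> x /multiplesP [y ->]; apply/multiplesP; exists (t ^+ i *: y).
    by rewrite scalerA -exprD subnK.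
  split.
    move=> x /multiplesP [y ->]; apply/multiplesP; exists (t *: y).
    by rewrite scalerA -exprSr -subSn.
  move=> sub; have /sub/multiplesP [y] :
      t ^+ (m - i.+1) *: g \in multiples N (t ^+ (m - i.+1)).
    by apply/multiplesP; exists g.
  rewrite -(subnSK im); case: (uniserial y) => [->|[j [a [b [-> _]]]]].
    rewrite scaler0 => eq0; apply: (@strict (m - i.+1) 0).
    by rewrite eq0 mul0r scale0r.
  rewrite scalerA mulrCA mulrA mulrAC => eqg.
  exact: (@strict (m - i.+1) (a * t ^+ j)).
move=> l C [btw C_strict].
(* Invariant carried up the chain: [C i] contains t^j g for some j with j + i at most [m]. *)
suff [j jl _] : exists2 j, (j + l <= m)%N & t ^+ j *: g \in C l.
  exact: leq_trans (leq_addl _ _) jl.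
have: (l <= l)%N by [].
elim: {-2}l => [|i IH] il.
  have [_ sub _] := btw 0%N il; exists m; first by rewrite addn0.
  by apply: sub; apply/multiplesP; exists g.
have [j jm tj] := IH (ltnW il).
have [[C0 CZ] _ _] := btw i (ltnW il).
have [[C01 CZ1] _ _] := btw i.+1 il.
have [_ nsub] := C_strict i il.
(* A nonzero [x] in [C i.+1] is associate to t^j' g; if no exponent below [j] occurred, [x] would be
   a multiple of t^j g and lie in [C i]. *)
apply: contra_notP nsub => none x xC.
case: (uniserial x) => [-> //|[j' [a [b [xE tE]]]]].
have tj' : t ^+ j' *: g \in C i.+1.
  by rewrite tE -[_ *: _]addr0; apply: CZ1.
have [j'j|jj'] := ltnP j' j.
  case: none; exists j' => //; apply: leq_trans jm.
  by rewrite addnS -addSn leq_add2r.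
rewrite xE -(subnK jj') exprD mulrA -scalerA -[_ *: _]addr0; exact: CZ.
Qed.

End UniserialLength.

(** The factorization is required only of the actions on [N], because the one of the determinant is
    obtained only along the curve. *)
Lemma multiples_unit (R : comNzRingType) (N : lmodType R) (f h u v : R) :
  v * u = 1 -> (forall x : N, f *: x = (u * h) *: x) ->
  multiples N f = multiples N h.
Proof.
move=> vu fE; apply/funext => x; apply/multiplesP/multiplesP => [][y ->].
  by exists (u *: y); rewrite fE scalerA mulrC.
by exists (v *: y); rewrite fE scalerA mulrAC [u * v]mulrC vu mul1r.
Qed.

(** * Generators and annihilators of cyclic modules *)

Section CyclicModule.
Variables (R : comNzRingType) (S : R -> Prop).

Lemma mem_ideal_gen x : S x -> x \in ideal_gen S.
Proof.
move=> Sx; apply/asboolP; exists [:: (1, x)].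
by rewrite big_seq1 mul1r; split=> // p; rewrite inE => /eqP ->.
Qed.

Definition cyclic_gen : cyclic_module S := cyclic_proj S 1.

Lemma cyclic_genZ a : a *: cyclic_gen = cyclic_proj S a.
Proof. by rewrite -[a in RHS]mulr1 -cyclic_scaleE. Qed.

Lemma cyclic_genP (x : cyclic_module S) : exists a, x = a *: cyclic_gen.
Proof. by rewrite -[x]cyclic_projP; eexists; rewrite cyclic_genZ. Qed.

Lemma cyclic_gen_ann a : a *: cyclic_gen = 0 <-> a \in ideal_gen S.
Proof.
rewrite -(scale0r cyclic_gen) !cyclic_genZ -[a in a \in _]subr0.
by rewrite -cyclic_proj_eq; split=> /eqP.
Qed.

End CyclicModule.

(** * The local ring of affine space and ideals extended to it *)

Section LocalRing.
Variables (k : fieldType) (N : nat) (c : 'I_N -> k).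
Implicit Types (p q : {mpoly k[N]}) (x : local_ring c).

Fact germ_zmod_morphism : zmod_morphism (germ c).
Proof. by move=> p q; apply: val_inj; rewrite /= tofracB. Qed.

Fact germ_monoid_morphism : monoid_morphism (germ c).
Proof.
by split=> [|p q]; apply: val_inj; rewrite /= ?tofrac1 ?tofracM.
Qed.

HB.instance Definition _ := GRing.isZmodMorphism.Build
  {mpoly k[N]} (local_ring c) (germ c) germ_zmod_morphism.
HB.instance Definition _ := GRing.isMonoidMorphism.Build
  {mpoly k[N]} (local_ring c) (germ c) germ_monoid_morphism.

Lemma germ_inj : injective (germ c).
Proof.
by move=> p q /(congr1 val) /eqP; rewrite /= tofrac_eq => /eqP.
Qed.

Lemma local_ring_mulf_eq0 x y : x * y = 0 -> x = 0 \/ y = 0.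
Proof.
move=> /(congr1 val) /eqP; rewrite /= mulf_eq0.
by case/orP => /eqP xy0; [left|right]; apply: val_inj.
Qed.

Lemma tofrac_neq0 q : q.@[c] != 0 -> tofrac q != 0.
Proof.
by rewrite tofrac_eq0; apply: contraNneq => ->; rewrite meval0.
Qed.

Lemma local_ringP x : exists p q, q.@[c] != 0 /\ germ c q * x = germ c p.
Proof.
have /asboolP [p [q [q0 xE]]] := valP x; exists p, q; split=> //.
by apply: val_inj; rewrite /= xE mulrC divfK ?tofrac_neq0.
Qed.

Lemma germ_unit q : q.@[c] != 0 -> exists s : local_ring c, s * germ c q = 1.
Proof.
move=> q0; have qV : (tofrac q)^-1 \in regular_at c.
  by apply/asboolP; exists 1, q; rewrite tofrac1 div1r.
exists (Sub (tofrac q)^-1 qV : local_ring c); apply: val_inj.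
by rewrite /= mulVf ?tofrac_neq0.
Qed.

Variable I : {pred {mpoly k[N]}}.
Hypothesis I0 : 0 \in I.
Hypothesis ID : forall p q, p \in I -> q \in I -> p + q \in I.
Hypothesis IM : forall p q, p \in I -> q * p \in I.

Notation gen := (cyclic_gen (fun f => exists2 p, p \in I & f = germ c p)).

(** The finitely many coefficients have a common denominator, a product of polynomials not vanishing
    at [c]. *)
Lemma local_ideal_clear x :
  x *: gen = 0 -> exists q p,
    [/\ q.@[c] != 0, p \in I & germ c q * x = germ c p].
Proof.
move=> /cyclic_gen_ann /asboolP [s [sI ->]].
elim: s sI => [|[a b] s IH] sI.
  exists 1, 0; rewrite big_nil meval1 oner_neq0 mulr0.
  by split=> //; rewrite rmorph0.
have [|q [p [q0 pI qE]]] := IH.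
  by move=> d ds; apply: sI; rewrite inE ds orbT.
have [b' b'I bE] := sI (a, b) (mem_head _ _).
have [a' [r [r0 rE]]] := local_ringP a.
exists (q * r), (q * a' * b' + r * p); split.
- by rewrite mevalM mulf_neq0.
- by apply: ID; apply: IM.
rewrite big_cons /= mulrDr !rmorphD !rmorphM /= -rE -qE -bE /=.
by congr (_ + _); rewrite !mulrA // [germ c q * _]mulrC.
Qed.

(** Contracting the extended ideal gives the saturation of [I] at [c]; injectivity of [germ] turns
    the equation in the local ring into one between polynomials. *)
Lemma local_module_germ_eq0 p :
  germ c p *: gen = 0 <-> exists q, q.@[c] != 0 /\ q * p \in I.
Proof.
split=> [/local_ideal_clear [q [p' [q0 p'I]]]|[q [q0 qp]]].
  by rewrite -rmorphM => /germ_inj qpE; exists q; rewrite qpE.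
have [s sq] := germ_unit q0; rewrite -[germ c p]mul1r -sq -mulrA -rmorphM.
rewrite -scalerA; suff -> : germ c (q * p) *: gen = 0 by rewrite scaler0.
by apply/cyclic_gen_ann/mem_ideal_gen; exists (q * p).
Qed.

End LocalRing.

(** * The comorphism of an operator curve *)

Section CurveComorphism.
Variables (k : closedFieldType) (n : nat) (L : {poly 'M[k]_n.+1}).

HB.instance Definition _ := GRing.RMorphism.copy (curve_comorphism L)
  (mmap (@polyC k) (curve_coord L)).

Lemma horner_curve_mx l : map_mx (horner_eval l) (curve_mx L) = curve_at L l.
Proof.
apply/matrixP => i j; rewrite !mxE /horner_eval horner_poly summxE.
by apply: eq_bigr => m _; rewrite mxE mulrC.
Qed.

Lemma horner_curve_coord l a : (curve_coord L a).[l] = curve_point L l a.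
Proof.
case/mxvec_indexP: a => i j; rewrite /curve_coord /curve_point !mxvecE.
by rewrite -horner_curve_mx [RHS]mxE.
Qed.

(** By this, a polynomial is invertible at the point L(l) exactly when its pullback does not vanish
    at [l]. *)
Lemma horner_curve_comorphism p l :
  (curve_comorphism L p).[l] = p.@[curve_point L l].
Proof.
rewrite mevalE /curve_comorphism /mmap horner_sum; apply: eq_bigr => m _.
rewrite hornerM hornerC /mmap1 horner_prod; congr (_ * _).
by apply: eq_bigr => a _; rewrite horner_exp horner_curve_coord.
Qed.

Lemma curve_comorphism_det :
  curve_comorphism L (\det (generic_mx k n)) = \det (curve_mx L).
Proof.
rewrite -det_map_mx; congr (\det _); apply/matrixP => i j.
by rewrite !mxE [LHS]mmapX mmap1U /curve_coord mxvecE !mxE.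
Qed.

Lemma horner_curve_det l : (\det (curve_mx L)).[l] = \det (curve_at L l).
Proof. by rewrite -horner_curve_mx det_map_mx. Qed.

End CurveComorphism.

(** * The local ring of the curve *)

(** The ideal of the curve is already saturated: the pullback of a denominator [q] does not vanish
    at [l], so it is nonzero and cancels in the domain k[X]. *)
Lemma curve_module_ann (k : closedFieldType) n (L : {poly 'M[k]_n.+1}) l
    (c := curve_point L l) p :
  germ c p *: cyclic_gen _ = 0 :> local_module c (curve_ideal L) <->
  curve_comorphism L p = 0.
Proof.
have kerP q : reflect (curve_comorphism L q = 0) (q \in curve_ideal L).
  exact: eqP.
have I0 : 0 \in curve_ideal L by apply/kerP; rewrite rmorph0.
have ID p1 p2 : p1 \in curve_ideal L -> p2 \in curve_ideal L ->
    p1 + p2 \in curve_ideal L.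
  by move=> /kerP p1I /kerP p2I; apply/kerP; rewrite rmorphD /= p1I p2I addr0.
have IM p1 q : p1 \in curve_ideal L -> q * p1 \in curve_ideal L.
  by move=> /kerP p1I; apply/kerP; rewrite rmorphM /= p1I mulr0.
split=> [/(local_module_germ_eq0 _ I0 ID IM) [q [q0]]|p0].
  move/kerP; rewrite rmorphM => /eqP; rewrite mulf_eq0.
  case/orP => /eqP // qI; move: q0; rewrite -horner_curve_comorphism.
  by rewrite qI horner0 eqxx.
by apply/cyclic_gen_ann/mem_ideal_gen; exists p => //; apply/kerP.
Qed.

(** The generic determinant is nonzero because its pullback is, and the local ring is a domain. *)
Lemma generic_det_regular (k : closedFieldType) n (c : 'I_(adim n) -> k)
    (L : {poly 'M[k]_n.+1}) (x : local_ring c) :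
  \det (curve_mx L) != 0 -> germ c (\det (generic_mx k n)) * x = 0 -> x = 0.
Proof.
move=> D_neq0 /local_ring_mulf_eq0 [f0|//]; case/eqP: D_neq0.
rewrite -curve_comorphism_det.
have /germ_inj -> : germ c (\det (generic_mx k n)) = germ c 0.
  by rewrite rmorph0.
by rewrite rmorph0.
Qed.

(* The local ring [R] enters only through its localization map [loc]; [N] is the
   local ring of the curve, as an [R]-module generated by [g]. *)
Section AdmissibleCurve.
Variables (k : closedFieldType) (n : nat) (L : {poly 'M[k]_n.+1}) (l0 : k).
Let c := curve_point L l0.
Let phi := curve_comorphism L.
Variables (R : comNzRingType) (loc : {rmorphism {mpoly k[adim n]} -> R}).
Hypothesis loc_frac : forall x, exists p q, q.@[c] != 0 /\ loc q * x = loc p.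
Hypothesis loc_unit : forall q, q.@[c] != 0 -> exists s, s * loc q = 1.
Variables (N : lmodType R) (g : N).
Hypothesis g_gen : forall x, exists a, x = a *: g.
Hypothesis g_ann : forall p, loc p *: g = 0 <-> phi p = 0.
Hypothesis adL : admissible L.
Hypothesis D_neq0 : \det (curve_mx L) != 0.
Variable t : {mpoly k[adim n]}.
Hypothesis phit : phi t = 'X - l0%:P.

Lemma curve_module_germ_eq p q :
  loc p *: g = loc q *: g <-> phi p = phi q.
Proof.
split=> [pq|pq]; apply/eqP; rewrite -subr_eq0; apply/eqP.
  by rewrite /phi -rmorphB; apply/g_ann; rewrite rmorphB scalerBl pq subrr.
rewrite -scalerBl -rmorphB; apply/g_ann.
by rewrite /phi rmorphB /= -/phi pq subrr.
Qed.

(** A nonzero element is a unit times some [loc p *: g]. Splitting off the order [j] of [phi p] at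
    [l0] leaves a cofactor [h] with h(l0) nonzero; admissibility lifts [h] to a polynomial, which is
    a unit at [c]. *)
Lemma curve_module_uniserial (x : N) : x = 0 \/ exists j a b,
  x = (a * loc t ^+ j) *: g /\ loc t ^+ j *: g = b *: x.
Proof.
have [a ->] := g_gen x.
have [p [q [q0 qa]]] := loc_frac a; have [s sq] := loc_unit q0.
have -> : a = s * loc p by rewrite -qa mulrA sq mul1r.
have [p0|p_neq0] := eqVneq (phi p) 0.
  by left; move/g_ann: p0; rewrite -scalerA => ->; rewrite scaler0.
have [j [h]] := multiplicity_XsubC (phi p) l0; rewrite p_neq0 /= => h0 phip.
have [gam gamE] := adL.2 h.
have [r rE] : exists r, r * loc gam = 1.
  by apply: loc_unit; rewrite -horner_curve_comorphism gamE.
have pE : loc p *: g = (loc gam * loc t ^+ j) *: g.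
  rewrite -rmorphXn -rmorphM; apply/curve_module_germ_eq.
  by rewrite phip /phi rmorphM rmorphXn /= gamE -/phi phit.
have xE : (s * loc p) *: g = (s * loc gam * loc t ^+ j) *: g.
  transitivity (s *: (loc p *: g)); first by rewrite scalerA.
  by rewrite pE scalerA mulrA.
(* [r * loc q] is the inverse of the unit [s * loc gam]. *)
right; exists j, (s * loc gam), (r * loc q); rewrite xE; split=> //.
rewrite scalerA; congr (_ *: _); rewrite -!mulrA [loc q * _]mulrA.
by rewrite [loc q * s]mulrC sq mul1r mulrA rE mul1r.
Qed.

(** With a = p/q, equality would give phi(q) (X - l0)^j = phi(p) (X - l0)^(j+1); cancelling the
    power and evaluating at [l0] forces q(c) = 0. *)
Lemma curve_module_strict j a :
  loc t ^+ j *: g <> (a * loc t ^+ j.+1) *: g.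
Proof.
have [p [q [q0 qa]]] := loc_frac a.
move=> /(congr1 ( *:%R (loc q))); rewrite !scalerA mulrA qa.
rewrite -!rmorphXn -!rmorphM => /curve_module_germ_eq.
rewrite /phi !rmorphM !rmorphXn /= -/phi phit exprS mulrA.
have Xj0 : ('X - l0%:P) ^+ j != 0 :> {poly k}.
  by rewrite expf_neq0 ?polyXsubC_eq0.
move=> /(mulIf Xj0) /(congr1 (fun P => P.[l0])).
rewrite hornerM hornerXsubC subrr mulr0 /phi horner_curve_comorphism => /eqP.
by rewrite (negPf q0).
Qed.

(** If the determinant kills a nonzero [x], it kills the associate t^j g, so det L times (X - l0)^j
    is zero in k[X]. *)
Lemma det_regular_curve_module (x : N) :
  loc (\det (generic_mx k n)) *: x = 0 -> x = 0.
Proof.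
case: (curve_module_uniserial x) => // [[j [a [b [_ tx]]]]] fx.
have : (loc (\det (generic_mx k n)) * loc t ^+ j) *: g = 0.
  by rewrite -scalerA tx scalerA mulrC -scalerA fx scaler0.
rewrite -rmorphXn -rmorphM => /g_ann /eqP.
rewrite /phi rmorphM rmorphXn /= -/phi phit /phi curve_comorphism_det.
by rewrite mulf_eq0 (negPf D_neq0) expf_eq0 polyXsubC_eq0 andbF.
Qed.

(** In det L = h (X - l0)^m with h(l0) nonzero, [h] lifts to a unit [loc gam], and the determinant
    acts on [N] as this unit times t^m. *)
Lemma multiples_det :
  multiples N (loc (\det (generic_mx k n))) =
  multiples N (loc t ^+ alg_mult L l0).
Proof.
have [m [h]] := multiplicity_XsubC (\det (curve_mx L)) l0.
rewrite D_neq0 /= => h0 DE.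
have -> : alg_mult L l0 = m.
  by rewrite /alg_mult DE mupMr // mup_XsubCX eqxx.
have [gam gamE] := adL.2 h.
have [r rE] : exists r, r * loc gam = 1.
  by apply: loc_unit; rewrite -horner_curve_comorphism gamE.
apply: multiples_unit rE _ => x; have [a ->] := g_gen x.
rewrite !scalerA ![_ * a]mulrC -!scalerA; congr (_ *: _).
rewrite scalerA -rmorphXn -rmorphM; apply/curve_module_germ_eq.
rewrite /phi rmorphM rmorphXn /= -/phi phit /phi gamE curve_comorphism_det.
by rewrite DE.
Qed.

End AdmissibleCurve.

(** * The determinantal hypersurface and the multiplicity formula *)

(** The extension of a principal ideal is principal: the cleared denominator is a unit and moves
    into the cofactor. *)
Lemma singular_module_ann (k : closedFieldType) n (c : 'I_(adim n) -> k) a :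
  a *: cyclic_gen _ = 0 :> local_module c (singular_ideal k n) <->
  exists b, a = germ c (\det (generic_mx k n)) * b.
Proof.
have singP p : reflect (exists q, p = q * \det (generic_mx k n))
  (p \in singular_ideal k n) by exact: asboolP.
split=> [|[b ->]]; last first.
  rewrite mulrC -scalerA.
  suff -> : germ c (\det (generic_mx k n)) *: cyclic_gen _ = 0
    :> local_module c (singular_ideal k n) by rewrite scaler0.
  apply/cyclic_gen_ann/mem_ideal_gen; exists (\det (generic_mx k n)) => //.
  by apply/singP; exists 1; rewrite mul1r.
have I0 : 0 \in singular_ideal k n by apply/singP; exists 0; rewrite mul0r.
have ID p q : p \in singular_ideal k n -> q \in singular_ideal k n ->
    p + q \in singular_ideal k n.
  by move=> /singP [p' ->] /singP [q' ->]; apply/singP; exists (p' + q');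
    rewrite mulrDl.
have IM p q : p \in singular_ideal k n -> q * p \in singular_ideal k n.
  by move=> /singP [p' ->]; apply/singP; exists (q * p'); rewrite mulrA.
case/(local_ideal_clear I0 ID IM).
move=> q [p [q0 /singP [p' ->] qa]]; have [s sq] := germ_unit q0.
exists (s * germ c p').
by rewrite -[a]mul1r -sq -mulrA qa rmorphM /= [LHS]mulrA mulrC.
Qed.

Theorem theorem2p1 (k : closedFieldType) (n : nat) (L : {poly 'M[k]_n.+1})
    (adL : admissible L) (sigmaL : ~ (forall l : k, l \in spectrum L))
    (l0 : k) (hl0 : l0 \in spectrum L) :
  (alg_mult L l0)%:Z
    = intersection_multiplicity (curve_point L l0)
        (singular_ideal k n) (curve_ideal L).
Proof.
have D_neq0 : \det (curve_mx L) != 0.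
  apply: contra_notN sigmaL => /eqP D0 l.
  by rewrite unfold_in /spectrum -horner_curve_det D0 horner0.
have [t tE] := adL.2 ('X - l0%:P).
pose c := curve_point L l0.
pose g : local_module c (curve_ideal L) := cyclic_gen _.
have g_gen x : exists a, x = a *: g by apply: cyclic_genP.
have g_ann : forall p, germ c p *: g = 0 <-> curve_comorphism L p = 0.
  exact: curve_module_ann.
have f_regN := det_regular_curve_module (@local_ringP _ _ c) (@germ_unit _ _ c)
  g_gen g_ann adL D_neq0 tE.
have := uniserial_length
  (curve_module_uniserial (@local_ringP _ _ c) (@germ_unit _ _ c)
    g_gen g_ann adL tE)
  (curve_module_strict (@local_ringP _ _ c) g_ann tE) (alg_mult L l0).
rewrite -(multiples_det (@germ_unit _ _ c) g_gen g_ann adL D_neq0 tE) => len.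
have torE := hypersurface_tor_length
  (fun x => @generic_det_regular _ _ c _ x D_neq0)
  (@cyclic_genP _ _) (@singular_module_ann _ _ c) f_regN len.
(* The alternating sum reduces to its term of index 0, the length of N/fN. *)
rewrite /intersection_multiplicity big_ord_recl big1 => [|i _].
  by rewrite torE expr0 mul1r addr0.
by rewrite torE mulr0.
Qed.
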